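(* Let $m$ be an even positive integer, $n$ a positive integer, and let $\mathcal{C}$ be an order $m$ dimension $n$ symmetric Cauchy tensor with generating vector $c=(c_1,\ldots,c_n)\in\mathbb{R}^n$. Then $\mathcal{C}$ is positive semi-definite if and only if $c>0$, i.e. $c_i>0$ for all $i\in[n]$.
   Context: $[n]=\{1,\ldots,n\}$. An order $m$ dimension $n$ symmetric Cauchy tensor with generating vector $c=(c_1,\ldots,c_n)\in\mathbb{R}^n$ is the real tensor $\mathcal{C}=(c_{i_1\cdots i_m})$ with entries $c_{i_1i_2\cdots i_m}=\frac{1}{c_{i_1}+c_{i_2}+\cdots+c_{i_m}}$, $i_1,\ldots,i_m\in[n]$, where it is assumed that $c_{i_1}+\cdots+c_{i_m}\neq 0$ for all $i_1,\ldots,i_m\in[n]$ (so in particular all $c_i\ne 0$). An order $m$ dimension $n$ tensor $\mathcal{A}=(a_{i_1\cdots i_m})$ is positive semi-definite if $\mathcal{A}x^m:=\sum_{i_1,\ldots,i_m\in[n]}a_{i_1\cdots i_m}x_{i_1}\cdots x_{i_m}\ge 0$ for all $x\in\mathbb{R}^n$. *)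

(* Defs.v *)
From mathcomp Require Import all_boot all_order all_algebra.
From mathcomp Require Import reals.

Set Implicit Arguments.
Unset Strict Implicit.
Unset Printing Implicit Defensive.

Import Order.TTheory GRing.Theory Num.Theory.
Local Open Scope ring_scope.

(* Multi-indices (i_1, ..., i_m) are finite functions 'I_m -> 'I_n, so the
   index set [n] is shifted to start at 0. *)
Definition tensor (R : Type) (m n : nat) := {ffun 'I_m -> 'I_n} -> R.

Definition tensor_form (R : realType) (m n : nat) (A : tensor R m n)
    (x : 'rV[R]_n) : R :=
  \sum_(i : {ffun 'I_m -> 'I_n}) A i * \prod_(k < m) x 0 (i k).

Definition positive_semidefinite (R : realType) (m n : nat)
    (A : tensor R m n) : Prop :=
  forall x : 'rV[R]_n, 0 <= tensor_form A x.

(* The first conjunct is part of the notion: since 0^-1 = 0 here, the formula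
   alone would also make sense for vectors that generate no Cauchy tensor. *)
Definition symmetric_cauchy_tensor (R : realType) (m n : nat)
    (c : 'rV[R]_n) (A : tensor R m n) : Prop :=
  (forall i : {ffun 'I_m -> 'I_n}, \sum_(k < m) c 0 (i k) != 0) /\
  (forall i : {ffun 'I_m -> 'I_n}, A i = 1 / \sum_(k < m) c 0 (i k)).

(* Main.v *)
Require Import Defs.
From mathcomp Require Import all_boot all_order all_algebra.
From mathcomp Require Import reals.
From mathcomp Require Import boolp classical_sets functions topology.
From mathcomp Require Import normedtype derive sequences exp.

Set Implicit Arguments.
Unset Strict Implicit.
Unset Printing Implicit Defensive.

Import Order.TTheory GRing.Theory Num.Theory.
Import numFieldNormedType.Exports.
Local Open Scope ring_scope.

(** For positive generators, the Cauchy form is the integral over [t >= 0] of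
    [(\sum_j x_j e^(-c_j t)) ^ m], which is nonnegative for even [m]. Integration
    is avoided by working with the primitive
    [F t = \sum_i a_i / s_i * e^(-s_i t)], where [i] ranges over multi-indices:
    its derivative is minus the integrand, so it is nonincreasing, and it tends
    to [0] at infinity, whence [F 0 >= 0]. Conversely, evaluating the form at a
    basis vector yields [1 / (m c_i) >= 0]. *)

Section ExponentialSum.
Context {R : realType} {I : finType}.
Implicit Types a s : I -> R.

Lemma is_derive_expR_sum a s (t : R) :
  is_derive t 1 (fun u : R => \sum_i a i * expR (- (s i * u)))
    (- \sum_i (a i * s i) * expR (- (s i * t))).
Proof.
(* Seen as a sum of functions, it can be differentiated by induction on the sum. *)
have -> : (fun u : R => \sum_i a i * expR (- (s i * u))) =
    \sum_i (fun u : R => a i * expR (- (s i * u))).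
  by apply: funext => u; rewrite fct_sumE.
rewrite -sumrN.
elim/big_ind2 : _ => [|f df g dg hf hg|i _].
- exact: is_derive_cst.
- exact: is_deriveD.
- have h : is_derive t 1 (fun u : R => - (s i * u)) (- s i).
    by apply: is_derive_eq; rewrite scaler1.
  by apply: is_derive_eq; rewrite /GRing.scale/= !mulrN -mulrA [expR _ * _]mulrC.
Qed.

Lemma cvg_expR_sum a s : (forall i, 0 < s i) ->
  (\sum_i a i * expR (- (s i * t)) @[t --> +oo] --> (0 : R))%classic.
Proof.
move=> s_gt0.
have {2}-> : 0 = \sum_i a i * 0 :> R by rewrite big1// => i _; rewrite mulr0.
apply: cvg_big => [|i _]; first exact: add_continuous.
apply: cvgMl_tmp.
apply: (@cvg_comp _ _ _ ( *%R (s i)) (fun t => expR (- t)) _ (pinfty_nbhs R)).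
  exact: gt0_cvgMry.
exact: cvgr_expR.
Qed.

Lemma expR_sum_div_ge0 a s : (forall i, 0 < s i) ->
  (forall t, 0 <= \sum_i a i * expR (- (s i * t))) ->
  0 <= \sum_i a i / s i.
Proof.
move=> s_gt0 sum_ge0.
pose F (t : R) := \sum_i (a i / s i) * expR (- (s i * t)).
have dF (t : R) : is_derive t 1 F (- \sum_i a i * expR (- (s i * t))).
  apply: is_derive_eq; first exact: is_derive_expR_sum.
  by congr (- _); apply: eq_bigr => i _; rewrite divfK ?gt_eqF.
have F0 : F 0 = \sum_i a i / s i.
  by apply: eq_bigr => i _; rewrite mulr0 oppr0 expR0 mulr1.
(* Since [F] tends to [0], it suffices that [F t <= F 0] for all large [t]. *)
rewrite -F0; apply: (cvgr_to_le (cvg_expR_sum (fun i => a i / s i) s_gt0)).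
near=> t.
apply: (@ler0_derive1_nincry _ F 0) => // [u _|].
- by rewrite derive1E derive_val oppr_le0.
- by apply: derivable_within_continuous => u _; have [] := dF u.
Unshelve. all: end_near. Qed.

End ExponentialSum.

(** Distributivity: a multi-index [i] picks the summand [y (i k)] from the [k]-th factor. *)
Lemma expr_sum_ffun (R : comPzSemiRingType) (m n : nat) (y : 'I_n -> R) :
  (\sum_j y j) ^+ m = \sum_(i : {ffun 'I_m -> 'I_n}) \prod_(k < m) y (i k).
Proof.
by rewrite -(bigA_distr_bigA (fun _ : 'I_m => y)) prodr_const card_ord.
Qed.

(** Any multi-index other than the constant one has an entry different from [j], where the basis
    vector vanishes. *)
Lemma tensor_form_delta (R : realType) (m n : nat) (A : tensor R m n)
    (j : 'I_n) :
  tensor_form A (delta_mx 0 j) = A [ffun=> j].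
Proof.
rewrite /tensor_form (bigD1 [ffun=> j])//= [X in _ + X]big1 => [|i /eqP ij].
  rewrite big1 ?addr0 ?mulr1// => k _.
  by rewrite mxE ffunE !eqxx.
have [k ikj] : exists k, i k != j.
  apply/existsP; apply: contra_notT ij => /existsPn ij.
  by apply/ffunP => k; rewrite ffunE; apply/eqP/negPn/ij.
by rewrite (bigD1 k)//= mxE (negPf ikj) andbF mul0r mulr0.
Qed.

Theorem theorem2p1 (R : realType) (m n : nat)
    (m_gt0 : (0 < m)%N) (m_even : ~~ odd m) (n_gt0 : (0 < n)%N)
    (c : 'rV[R]_n) (C : tensor R m n)
    (hC : symmetric_cauchy_tensor c C) :
  positive_semidefinite C <-> (forall i : 'I_n, 0 < c 0 i).
Proof.
have [sum_neq0 CE] := hC; split => [psdC j|c_gt0 x].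
  have mc_neq0 := sum_neq0 [ffun=> j].
  have := psdC (delta_mx 0 j); rewrite tensor_form_delta CE div1r invr_ge0.
  (* Since [0^-1 = 0], a nonnegative inverse leaves a zero sum possible; the Cauchy condition
     excludes it. *)
  rewrite le_eqVlt eq_sym (negPf mc_neq0)/= => {mc_neq0}.
  under eq_bigr do rewrite ffunE.
  by rewrite sumr_const card_ord pmulrn_lgt0.
rewrite /tensor_form.
(* This gives the shape [a i / s i], with [a i] the product of the [x] entries and [s i] the sum of
   the generators. *)
under eq_bigr do rewrite CE div1r mulrC.
apply: expR_sum_div_ge0 => [i|t].
  rewrite lt_neqAle eq_sym sum_neq0 sumr_ge0// => k _.
  exact: ltW.
(* The exponential of [s i * t] with negative sign factors over [k], so the sum is a perfect [m]-th
   power. *)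
have -> : \sum_(i : {ffun 'I_m -> 'I_n})
    \prod_(k < m) x 0 (i k) * expR (- ((\sum_(k < m) c 0 (i k)) * t)) =
    (\sum_j x 0 j * expR (- (c 0 j * t))) ^+ m.
  rewrite expr_sum_ffun; apply: eq_bigr => i _.
  by rewrite big_split/= -expR_sum mulr_suml sumrN.
exact: exprn_even_ge0.
Qed.
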